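(* Every finite irreducible nontrivial conformal module over the Heisenberg–Virasoro conformal algebra is isomorphic to a module of the form $$M_{\Delta,\alpha,\beta}=\mathbb{C}[\partial]v,\quad L_\lambda v=(\partial+\alpha+\Delta\lambda)v,\quad H_\lambda v=\beta v,$$ free of rank one over $\mathbb{C}[\partial]$ with generator $v$, for some $\Delta,\alpha,\beta\in\mathbb{C}$ with $\Delta\neq0$ or $\beta\neq0$.
   Context: A Lie conformal algebra is a $\mathbb{C}[\partial]$-module $\mathcal{A}$ with a $\mathbb{C}$-bilinear $\lambda$-bracket $\mathcal{A}\otimes\mathcal{A}\to\mathbb{C}[\lambda]\otimes\mathcal{A}$, $a\otimes b\mapsto[a_\lambda b]$, satisfying $[\partial a_\lambda b]=-\lambda[a_\lambda b]$, $[a_\lambda\partial b]=(\partial+\lambda)[a_\lambda b]$, $[a_\lambda b]=-[b_{-\lambda-\partial}a]$, and $[a_\lambda[b_\mu c]]=[[a_\lambda b]_{\lambda+\mu}c]+[b_\mu[a_\lambda c]]$. A conformal module over $\mathcal{A}$ is a $\mathbb{C}[\partial]$-module $V$ with a $\mathbb{C}$-bilinear map $\mathcal{A}\otimes V\to V[\lambda]$, $a\otimes v\mapsto a_\lambda v$, such that $a_\lambda(b_\mu v)-b_\mu(a_\lambda v)=[a_\lambda b]_{\lambda+\mu}v$, $(\partial a)_\lambda v=-\lambda a_\lambda v$, $a_\lambda(\partial v)=(\partial+\lambda)a_\lambda v$. It is finite if finitely generated over $\mathbb{C}[\partial]$; irreducible if it is nonzero and its only submodules are $0$ and itself; trivial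 if $a_\lambda v=0$ for all $a\in\mathcal{A}$, $v\in V$, and nontrivial otherwise. The Heisenberg–Virasoro conformal algebra is the Lie conformal algebra that is free over $\mathbb{C}[\partial]$ with basis $L,H$ and brackets $[L_\lambda L]=(\partial+2\lambda)L$, $[L_\lambda H]=(\partial+\lambda)H$, $[H_\lambda H]=0$. *)

(* Defs.v *)
From HB Require Import structures.
From mathcomp Require Import all_boot all_order all_algebra finmap.
From mathcomp.multinomials Require Import monalg.
From mathcomp Require Import reals complex.

Set Implicit Arguments.
Unset Strict Implicit.
Unset Printing Implicit Defensive.

Import GRing.Theory.

Local Open Scope ring_scope.

(* For a module V over a commutative ring R, [lpoly V] is V[x], the module over
   R[x] of polynomials in one variable with coefficients in V: finitely
   supported families of coefficients indexed by the exponents. *)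
Definition lpoly (R : comNzRingType) (V : lmodType R) : Type := @malg nat V.

HB.instance Definition _ (R : comNzRingType) (V : lmodType R) :=
  GRing.Zmodule.copy (lpoly V) (@malg nat V).

Section LPolyModule.
Variables (R : comNzRingType) (V : lmodType R).
Implicit Types (p : lpoly V) (q : {poly R}) (v : V) (n : nat).

Definition lcoef p n : V := mcoeff (K := nat) n p.

Definition lsupp p : seq nat := msupp (K := nat) p.

Definition lmono v n : lpoly V := mkmalgU (K := nat) n v.

Lemma lpolyP p1 p2 : lcoef p1 =1 lcoef p2 <-> p1 = p2.
Proof. exact: malgP. Qed.

Lemma lcoefD p1 p2 n : lcoef (p1 + p2) n = lcoef p1 n + lcoef p2 n.
Proof. exact: mcoeffD. Qed.

Lemma lcoef_sum (I : Type) (r : seq I) (P : pred I) (f : I -> lpoly V) n :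
  lcoef (\sum_(i <- r | P i) f i) n = \sum_(i <- r | P i) lcoef (f i) n.
Proof. exact: (raddf_sum (mcoeff (K := nat) n)). Qed.

Lemma lcoefU v k n : lcoef (lmono v k) n = if k == n then v else 0.
Proof. by rewrite /lcoef mcoeffU; case: eqP. Qed.

Lemma lsupp_uniq p : uniq (lsupp p). Proof. exact: fset_uniq. Qed.

Lemma lcoef_eq0 p n : (lcoef p n == 0) = (n \notin lsupp p).
Proof. exact: mcoeff_eq0. Qed.

Definition lpoly_scale q p : lpoly V :=
  \sum_(j < size q) \sum_(i <- lsupp p) lmono (q`_j *: lcoef p i) (j + i).

Lemma lcoef_scale q p n :
  lcoef (lpoly_scale q p) n = \sum_(j < n.+1) q`_j *: lcoef p (n - j).
Proof.
rewrite /lpoly_scale lcoef_sum.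
have inner (j : nat) :
    lcoef (\sum_(i <- lsupp p) lmono (q`_j *: lcoef p i) (j + i)) n
    = if (j < n.+1)%N then q`_j *: lcoef p (n - j) else 0.
  rewrite lcoef_sum; under eq_bigr do rewrite lcoefU.
  case: ltnP => [le_jn|lt_nj]; last first.
    by rewrite big1 // => i _; case: eqP => // E; move: lt_nj; rewrite -E ltnNge leq_addr.
  have [in_s|nin_s] := boolP ((n - j)%N \in lsupp p).
    rewrite (bigD1_seq _ in_s (lsupp_uniq p)) /= subnKC // eqxx big1 ?addr0 //.
    by move=> i ne_i; rewrite ifN //; apply: contra ne_i => /eqP<-; rewrite addKn.
  have E0 : lcoef p (n - j) = 0 by apply/eqP; rewrite lcoef_eq0.
  rewrite E0 scaler0 big_seq big1 // => i i_s.
  by case: eqP => // E; move: nin_s; rewrite -E addKn i_s.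
under eq_bigr do rewrite inner.
pose m := maxn (size q) n.+1.
rewrite (big_ord_widen m (fun j => if (j < n.+1)%N then q`_j *: lcoef p (n - j) else 0));
  last exact: leq_maxl.
rewrite (big_ord_widen m (fun j => q`_j *: lcoef p (n - j))); last exact: leq_maxr.
rewrite big_mkcond [RHS]big_mkcond /=; apply: eq_bigr => j _.
case: (ltnP j (size q)) => // le_sj.
by rewrite nth_default // scale0r; case: ifP.
Qed.

Lemma lpoly_scaleA q1 q2 p :
  lpoly_scale q1 (lpoly_scale q2 p) = lpoly_scale (q1 * q2) p.
Proof.
apply/lpolyP => n; rewrite !lcoef_scale.
under eq_bigr do rewrite lcoef_scale scaler_sumr.
under [RHS]eq_bigr do rewrite coefM scaler_suml.
pose G i j := q1`_i *: (q2`_j *: lcoef p (n - (i + j))).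
transitivity (\sum_(i < n.+1) \sum_(k < n.+1 | (i <= k)%N) G i (k - i)%N).
  apply: eq_bigr => i _.
  have le_in : (i <= n)%N by rewrite -ltnS.
  transitivity (\sum_(i <= k < n.+1) G i (k - i)%N); last first.
    by rewrite (big_nat_widenl i 0) //= big_mkord.
  rewrite -[X in index_iota X _]add0n big_addn subSn // big_mkord.
  by apply: eq_bigr => j _; rewrite /G addnK subnDA.
rewrite (exchange_big_dep predT) //=; apply: eq_bigr => k _.
rewrite (big_ord_widen n.+1 (fun i => (q1`_i * q2`_(k - i)) *: lcoef p (n - k))) //.
by apply: eq_big => i // le_ik; rewrite /G scalerA subnKC.
Qed.

Lemma lpoly_scale1 p : lpoly_scale 1 p = p.
Proof.
apply/lpolyP => n; rewrite lcoef_scale big_ord_recl /= coef1 scale1r subn0.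
by rewrite big1 ?addr0 // => i _; rewrite coef1 scale0r.
Qed.

Lemma lpoly_scaleDr : right_distributive lpoly_scale +%R.
Proof.
move=> q p1 p2; apply/lpolyP => n; rewrite lcoefD !lcoef_scale -big_split /=.
by apply: eq_bigr => j _; rewrite lcoefD scalerDr.
Qed.

Lemma lpoly_scaleDl p : {morph lpoly_scale^~ p : q1 q2 / q1 + q2}.
Proof.
move=> q1 q2; apply/lpolyP => n; rewrite lcoefD !lcoef_scale -big_split /=.
by apply: eq_bigr => j _; rewrite coefD scalerDl.
Qed.

HB.instance Definition _ := GRing.Zmodule_isLmodule.Build {poly R} (lpoly V)
  lpoly_scaleA lpoly_scale1 lpoly_scaleDr lpoly_scaleDl.

End LPolyModule.

Definition lconst (R : comNzRingType) (V : lmodType R) (v : V) : lpoly V :=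
  lmono v 0.

(* Substitution: for p = \sum_i x^i v_i, [lsubst f t p] is \sum_i t^i f(v_i).
   All coefficients are written to the right of the powers of t. *)
Definition lsubst (R S : comNzRingType) (V : lmodType R) (W : lmodType S)
    (f : V -> W) (t : S) (p : lpoly V) : W :=
  \sum_(i <- lsupp p) t ^+ i *: f (lcoef p i).

(* C[d]-modules are modules over {poly F}, d acting as 'X and the scalar c as
   c%:P.  V[lambda] is [lpoly V], over {poly {poly F}}, and V[lambda, mu] is
   [lpoly (lpoly V)], over {poly {poly {poly F}}}, with mu the outer variable. *)
Local Notation "V '[lambda]'" := (lpoly V) (at level 2, format "V [lambda]") : type_scope.
Local Notation "V '[lambda,mu]'" := (lpoly (lpoly V))
  (at level 2, format "V [lambda,mu]") : type_scope.

Section Action.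
Variable F : fieldType.

Definition d1 : {poly {poly F}} := 'X%:P.
Definition lambda1 : {poly {poly F}} := 'X.
Definition cst1 (c : F) : {poly {poly F}} := c%:P%:P.

Definition lambda2 : {poly {poly {poly F}}} := 'X%:P.
Definition mu2 : {poly {poly {poly F}}} := 'X.

Variables A V : lmodType {poly F}.
Implicit Types (op : A -> V -> V[lambda]) (a : A) (v : V) (c : F).

Definition C_bilinear op : Prop :=
  (forall c a a' v, op (c%:P *: a + a') v = cst1 c *: op a v + op a' v) /\
  (forall c a v v', op a (c%:P *: v + v') = cst1 c *: op a v + op a v').

Definition sesquilinear op : Prop :=
  (forall a v, op ('X *: a) v = - lambda1 *: op a v) /\
  (forall a v, op a ('X *: v) = (d1 + lambda1) *: op a v).

(* a_t v in V[lambda, mu], for t a polynomial in the two variables *)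
Definition act_at op (t : {poly {poly {poly F}}}) a v : V[lambda,mu] :=
  lsubst (fun w => lconst (lconst w)) t (op a v).

(* a_lambda (b_mu v) *)
Definition act_lambda_mu op a b v : V[lambda,mu] :=
  lsubst (act_at op lambda2 a) mu2 (op b v).

(* b_mu (a_lambda v) *)
Definition act_mu_lambda op b a v : V[lambda,mu] :=
  lsubst (act_at op mu2 b) lambda2 (op a v).

(* p_{lambda + mu} v for p in A[lambda], e.g. p = [a_lambda b] *)
Definition act_lambda_plus_mu op (p : A[lambda]) v : V[lambda,mu] :=
  lsubst (fun a => act_at op (lambda2 + mu2) a v) lambda2 p.

End Action.

Arguments d1 {F}.
Arguments lambda1 {F}.

Section LieConformalAlgebra.
Variable F : fieldType.

(* In [bracket_skew], -lambda - d is substituted for lambda, d acting on the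
   coefficients of [b_lambda a]. *)
Record lieConformalAlgebra := LieConformalAlgebra {
  lca_module :> lmodType {poly F};
  bracket : lca_module -> lca_module -> lca_module[lambda];
  bracket_bilinear : C_bilinear bracket;
  bracket_sesquilinear : sesquilinear bracket;
  bracket_skew : forall a b,
    bracket a b = - lsubst (@lconst _ _) (- lambda1 - d1) (bracket b a);
  bracket_jacobi : forall a b c,
    act_lambda_mu bracket a b c =
      act_lambda_plus_mu bracket (bracket a b) c + act_mu_lambda bracket b a c
}.

Variable A : lieConformalAlgebra.

Record conformalModule := ConformalModule {
  cmod_module :> lmodType {poly F};
  act : A -> cmod_module -> cmod_module[lambda];
  act_bilinear : C_bilinear act;
  act_sesquilinear : sesquilinear act;
  act_bracket : forall a b v,
    act_lambda_mu act a b v - act_mu_lambda act b a v =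
      act_lambda_plus_mu act (bracket a b) v
}.

Definition finite_module (V : conformalModule) : Prop :=
  exists s : seq V, forall v, exists p : nat -> {poly F},
    v = \sum_(i < size s) p i *: s`_i.

(* A submodule U is a C[d]-submodule with a_lambda u in U[lambda]. *)
Definition is_submodule (V : conformalModule) (U : V -> Prop) : Prop :=
  [/\ U 0,
      forall u u', U u -> U u' -> U (u + u'),
      forall (p : {poly F}) u, U u -> U (p *: u) &
      forall a u i, U u -> U (lcoef (act a u) i)].

Definition irreducible (V : conformalModule) : Prop :=
  (exists v : V, v <> 0) /\
  forall U : V -> Prop, is_submodule U ->
    (forall u, U u <-> u = 0) \/ (forall u, U u).

Definition trivial (V : conformalModule) : Prop :=
  forall (a : A) (v : V), act a v = 0.

Definition isomorphic (V W : conformalModule) : Prop :=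
  exists f : {linear V -> W}, bijective f /\
    forall a v i, f (lcoef (act a v) i) = lcoef (act a (f v)) i.

End LieConformalAlgebra.

Section HeisenbergVirasoro.
Variable F : fieldType.

Definition is_heisenberg_virasoro (A : lieConformalAlgebra F) (L H : A) : Prop :=
  [/\ forall a : A, exists! p : {poly F} * {poly F}, a = p.1 *: L + p.2 *: H,
      bracket L L = (d1 + 2%:R * lambda1) *: lconst L,
      bracket L H = (d1 + lambda1) *: lconst H &
      bracket H H = 0].

(* M is M_{Delta, alpha, beta}.  The values of L and H on the generator v
   determine the whole action, by sesquilinearity. *)
Definition is_M (A : lieConformalAlgebra F) (L H : A) (Delta alpha beta : F)
    (M : conformalModule A) : Prop :=
  exists v : M,
    [/\ forall w : M, exists! p : {poly F}, w = p *: v,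
        act L v = (d1 + cst1 alpha + cst1 Delta * lambda1) *: lconst v &
        act H v = cst1 beta *: lconst v].

End HeisenbergVirasoro.

(* Main.v *)
(* Write L_n, H_n for the coefficients of lambda^n in L_lambda, H_lambda on V.
   The operators L_0 - d and H_0 commute with d and with all L_n, H_n, so by
   Schur's lemma they are scalars alpha and beta.  The space V_N of vectors
   killed by all L_n, H_n with n >= N meets d^N V trivially, because
   (d + lambda)^N is monic in lambda, so V_N is finite-dimensional over the
   scalars; it is stable under L_n, H_n for n >= 1.  There H_N and then L_N
   act on V_(N+1) as ladder operators shifting the L_1-eigenvalue by -N and
   -(N-1), so starting from an L_1-eigenvector one descends to an eigenvector
   in V_2 which is killed by H_1.  It generates V, and V is torsion-free. *)

Require Import Defs.
From mathcomp Require Import all_boot all_order all_algebra.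
From mathcomp Require Import reals complex.
From mathcomp Require Import boolp ring zify.

Set Implicit Arguments.
Unset Strict Implicit.
Unset Printing Implicit Defensive.

Import Order.TTheory GRing.Theory Num.Theory.

Local Open Scope ring_scope.

(** * Coefficients of polynomials with values in a module *)

Section LPolyCoefficients.
Variables (R : comNzRingType) (V : lmodType R).
Implicit Types (p u : lpoly V) (q : {poly R}) (v : V) (n : nat).

Lemma lcoefZ q p n :
  lcoef (q *: p) n = \sum_(j < n.+1) q`_j *: lcoef p (n - j).
Proof. exact: lcoef_scale. Qed.

Lemma lcoef0 n : lcoef (0 : lpoly V) n = 0.
Proof. by apply: (@addrI _ (lcoef (0 : lpoly V) n)); rewrite -lcoefD !addr0. Qed.

Lemma lcoefN p n : lcoef (- p) n = - lcoef p n.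
Proof. by apply/eqP; rewrite -addr_eq0 -lcoefD addNr lcoef0. Qed.

Lemma lcoefB p1 p2 n : lcoef (p1 - p2) n = lcoef p1 n - lcoef p2 n.
Proof. by rewrite lcoefD lcoefN. Qed.

Lemma lcoefCZ c p n : lcoef (c%:P *: p) n = c *: lcoef p n.
Proof.
rewrite lcoefZ big_ord_recl coefC subn0 big1 ?addr0 // => i _.
by rewrite coefC scale0r.
Qed.

Lemma lcoefXnZ k p n :
  lcoef ('X^k *: p) n = if (k <= n)%N then lcoef p (n - k) else 0.
Proof.
rewrite lcoefZ; case: leqP => [le_kn|lt_nk].
  rewrite (bigD1 (Ordinal (le_kn : (k < n.+1)%N))) //= coefXn eqxx scale1r.
  rewrite big1 ?addr0 // => i; rewrite -val_eqE /= coefXn => /negPf ->.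
  by rewrite scale0r.
rewrite big1 // => i _; rewrite coefXn ltn_eqF ?scale0r //.
exact: leq_trans (ltn_ord i) lt_nk.
Qed.

Lemma lcoefZ_const q v n : lcoef (q *: lconst v) n = q`_n *: v.
Proof.
rewrite lcoefZ big_ord_recr /= subnn lcoefU eqxx big1 ?add0r // => i _.
by rewrite lcoefU ifN ?scaler0 // eq_sym subn_eq0 -ltnNge.
Qed.

Lemma lcoef_eventually0 p : exists N, forall n, (N <= n)%N -> lcoef p n = 0.
Proof.
exists (\max_(i <- lsupp p) i).+1 => n lt_n; apply/eqP; rewrite lcoef_eq0.
apply: contraTN lt_n => n_p; rewrite -leqNgt.
exact: (@leq_bigmax_seq _ (lsupp p) xpredT id n n_p).
Qed.

(** Substitutions are sums over the support of [p]; an initial segment as index range makes such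
    sums comparable for different [p]. The two hypotheses kill the terms in which the ranges
    differ. *)
Lemma sum_lsupp (W : nmodType) (f : nat -> W) p B :
    (forall i, lcoef p i = 0 -> f i = 0) ->
    (forall i, (B <= i)%N -> f i = 0) ->
  \sum_(i <- lsupp p) f i = \sum_(i < B) f i.
Proof.
move=> f0 fB; have [N pN] := lcoef_eventually0 p.
transitivity (\sum_(0 <= i < maxn N B) f i); last first.
  rewrite (@big_cat_nat _ _ _ B) //= ?leq_maxr // big_mkord.
  by rewrite [X in _ + X]big_nat_cond [X in _ + X]big1 ?addr0 // => i /andP[/andP[/fB]].
rewrite [RHS](bigID (fun i => i \in lsupp p)) /= [X in _ = _ + X]big1 ?addr0.
  rewrite -[RHS]big_filter; apply: perm_big; apply: uniq_perm.
  - exact: lsupp_uniq.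
  - by rewrite filter_uniq ?iota_uniq.
  move=> i; rewrite mem_filter mem_index_iota leq0n /= leq_max.
  case: (boolP (i \in lsupp p)) => //= ip; apply/esym/orP; left.
  rewrite ltnNge; apply: contraL ip => /pN /eqP.
  by rewrite lcoef_eq0.
by move=> i; rewrite -lcoef_eq0 => /eqP/f0.
Qed.

(** The hypothesis covers the case where [n] lies outside the support and the sum is empty of
    nonzero terms. *)
Lemma sum_lsupp_delta (W : nmodType) (f : nat -> W) p n :
    (lcoef p n = 0 -> f n = 0) ->
  \sum_(i <- lsupp p) (if i == n then f i else 0) = f n.
Proof.
move=> f0; rewrite (@sum_lsupp _ _ _ n.+1) => [|i pi|i lt_ni].
- rewrite big_ord_recr /= eqxx big1 ?add0r // => i _.
  by rewrite ltn_eqF.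
- by case: eqP pi => // -> /f0.
by rewrite gtn_eqF.
Qed.

(* The top coefficient of q u is the product of those of q and u. *)
Lemma lpoly_mul_low_eq0 q u :
    (forall v, lead_coef q *: v = 0 -> v = 0) ->
    (forall n, ((size q).-1 <= n)%N -> lcoef (q *: u) n = 0) -> u = 0.
Proof.
move=> reg_q low; have [N uN] := lcoef_eventually0 u.
(* Downward induction: [k] bounds the distance from [n] to the range where [u] is known to
   vanish. *)
suff H k n : (N <= n + k)%N -> lcoef u n = 0.
  by apply/lpolyP => n; rewrite lcoef0 (H N) ?leq_addl.
elim: k n => [|k IHk] n; first by rewrite addn0 => /uN.
move=> le_N; apply: reg_q; rewrite -(low _ (leq_addl n _)) lcoefZ.
have lt_q : ((size q).-1 < (n + (size q).-1).+1)%N by rewrite ltnS leq_addl.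
rewrite (bigD1 (Ordinal lt_q)) //= addnK [X in _ + X]big1 ?addr0 // => i.
rewrite -val_eqE /=; case: (ltngtP i (size q).-1) => // [lt_i|gt_i] _.
  rewrite IHk ?scaler0 //; apply: leq_trans le_N _.
  by rewrite -addnBA ?(ltnW lt_i) // -addnA leq_add2l -add1n leq_add2r subn_gt0.
by rewrite nth_default ?scale0r // (leq_trans (leqSpred _) gt_i).
Qed.

End LPolyCoefficients.

(** * Coefficients of the action in lambda and of iterated actions in lambda and mu *)

Section ActionCoefficients.
Variables (F : fieldType) (A V : lmodType {poly F}) (op : A -> V -> lpoly V).
Hypotheses (op_lin : C_bilinear op) (op_sesq : sesquilinear op).
Implicit Types (a b : A) (v w : V) (c : F) (p : {poly F}).

Lemma opDr a : {morph op a : v w / v + w}.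
Proof.
by move=> v w; have := op_lin.2 1 a v w; rewrite scale1r /cst1 scale1r.
Qed.

Lemma opDl a b v : op (a + b) v = op a v + op b v.
Proof. by have := op_lin.1 1 a b v; rewrite scale1r /cst1 scale1r. Qed.

Lemma op0r a : op a 0 = 0.
Proof. by apply: (@addIr _ (op a 0)); rewrite -opDr !add0r. Qed.

Lemma op0l v : op 0 v = 0.
Proof. by apply: (@addIr _ (op 0 v)); rewrite -opDl !add0r. Qed.

Lemma opCr a c v : op a (c%:P *: v) = cst1 c *: op a v.
Proof. by have := op_lin.2 c a v 0; rewrite op0r !addr0. Qed.

Lemma opCl a c v : op (c%:P *: a) v = cst1 c *: op a v.
Proof. by have := op_lin.1 c a 0 v; rewrite op0l !addr0. Qed.

(** The outer variable is lambda and the inner one d, so the factor is p(d + lambda). *)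
Lemma opZr a p v : op a (p *: v) = (p^:P \Po ('X + 'X%:P)) *: op a v.
Proof.
elim/poly_ind: p v => [|p c IHp] v.
  by rewrite map_poly0 comp_poly0 !scale0r op0r.
rewrite scalerDl -scalerA opDr IHp op_sesq.2 opCr scalerA -scalerDl.
congr (_ *: _); rewrite rmorphD rmorphM /= map_polyX map_polyC /=.
by rewrite comp_polyD comp_polyM comp_polyX comp_polyC [d1 + _]addrC.
Qed.

(** Here the factor is p(-lambda), since d on the left argument acts as -lambda. *)
Lemma opZl a p v : op (p *: a) v = (p^:P \Po (- 'X)) *: op a v.
Proof.
elim/poly_ind: p a => [|p c IHp] a.
  by rewrite map_poly0 comp_poly0 !scale0r op0l.
rewrite scalerDl -scalerA opDl IHp op_sesq.1 opCl scalerA -scalerDl.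
congr (_ *: _); rewrite rmorphD rmorphM /= map_polyX map_polyC /=.
by rewrite comp_polyD comp_polyM comp_polyX comp_polyC.
Qed.

Lemma lcoef_op_add a n : {morph (fun v => lcoef (op a v) n) : v w / v + w}.
Proof. by move=> v w; rewrite opDr lcoefD. Qed.

Lemma lcoef_opC a n c v :
  lcoef (op a (c%:P *: v)) n = c%:P *: lcoef (op a v) n.
Proof. by rewrite opCr lcoefCZ. Qed.

(** At lambda = 0 the factor p(d + lambda) becomes p(d). *)
Lemma lcoef_op0Z a p v : lcoef (op a (p *: v)) 0 = p *: lcoef (op a v) 0.
Proof.
rewrite opZr lcoefZ big_ord1 subn0 -horner_coef0 horner_comp !hornerE.
congr (_ *: _); exact: comp_polyXr.
Qed.

Lemma lcoef_opXl a v n :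
  lcoef (op ('X *: a) v) n = if n is m.+1 then - lcoef (op a v) m else 0.
Proof.
rewrite op_sesq.1 scaleNr lcoefN -[lambda1]expr1 lcoefXnZ.
by case: n => [|n]; rewrite ?oppr0 // subn1.
Qed.

(** The outer index [n] is the exponent of mu, the inner index [m] that of lambda. *)
Lemma lcoef2_act_at t a v n m :
  lcoef (lcoef (act_at op t a v) n) m =
  \sum_(i <- lsupp (op a v)) (t ^+ i)`_n`_m *: lcoef (op a v) i.
Proof.
rewrite /act_at /lsubst !lcoef_sum.
by apply: eq_bigr => i _; rewrite !lcoefZ_const.
Qed.

Lemma lcoef2_act_at_lambda a v n m :
  lcoef (lcoef (act_at op (lambda2 _) a v) n) m =
  if n == 0%N then lcoef (op a v) m else 0.
Proof.
rewrite lcoef2_act_at.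
under eq_bigr do rewrite -rmorphXn coefC.
case: (n == 0%N); last by rewrite big1 // => i _; rewrite coef0 scale0r.
rewrite -[RHS](@sum_lsupp_delta _ _ _ (lcoef (op a v)) (op a v)) //.
apply: eq_bigr => i _; rewrite coefXn eq_sym.
by case: eqP; rewrite ?scale1r ?scale0r.
Qed.

Lemma lcoef2_act_at_mu a v n m :
  lcoef (lcoef (act_at op (mu2 _) a v) n) m =
  if m == 0%N then lcoef (op a v) n else 0.
Proof.
rewrite lcoef2_act_at.
rewrite -(@sum_lsupp_delta _ _ _
    (fun i => if m == 0%N then lcoef (op a v) i else 0) (op a v)).
  apply: eq_bigr => i _; rewrite coefXn eq_sym.
  case: (i == n); last by rewrite coef0 scale0r.
  by rewrite coef1; case: eqP => _; rewrite ?scale1r ?scale0r.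
by move=> ->; case: ifP.
Qed.

(** Among the powers of lambda + mu, only the one of exponent m + n contains lambda^m mu^n. *)
Lemma lcoef2_act_at_sum a v n m :
  lcoef (lcoef (act_at op (lambda2 _ + mu2 _) a v) n) m =
  lcoef (op a v) (m + n) *+ 'C(m + n, n).
Proof.
rewrite lcoef2_act_at.
rewrite -(@sum_lsupp_delta _ _ _ (fun i => lcoef (op a v) i *+ 'C(m + n, n)) (op a v));
  last by move=> ->; rewrite mul0rn.
apply: eq_bigr => i _; rewrite exprDn coef_sum.
under eq_bigr => j _ do
  rewrite -rmorphXn /= -mulrnAl -rmorphMn coefCM coefXn mulr_natr mulrb.
rewrite -big_mkcond /=; case: (leqP n i) => [le_ni|lt_in].
  rewrite (big_pred1 (Ordinal (le_ni : (n < i.+1)%N))); last first.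
by move=> j; rewrite eq_sym.
  rewrite coefMn coefXn /=; case: eqP => [->|ne].
    by rewrite subnK // eqxx scaler_nat.
  by rewrite ifN ?mul0rn ?scale0r //; apply/eqP => E; case: ne; rewrite E addnK.
rewrite big_pred0; last first.
  by move=> j; apply/eqP => E; move: lt_in; rewrite E ltnNge -ltnS ltn_ord.
by rewrite coef0 scale0r ifN // ltn_eqF // ltn_addl.
Qed.

Lemma lcoef2_act_lambda_mu a b v n m :
  lcoef (lcoef (act_lambda_mu op a b v) n) m =
  lcoef (op a (lcoef (op b v) n)) m.
Proof.
rewrite /act_lambda_mu /lsubst !lcoef_sum.
rewrite -(@sum_lsupp_delta _ _ _ (fun i => lcoef (op a (lcoef (op b v) i)) m) (op b v));
  last by move=> ->; rewrite op0r lcoef0.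
apply: eq_bigr => i _; rewrite lcoefXnZ.
case: ltngtP => [lt_in|lt_ni|->]; last first.
- by rewrite subnn lcoef2_act_at_lambda.
- by rewrite lcoef0.
by rewrite lcoef2_act_at_lambda ifN // subn_eq0 -ltnNge.
Qed.

Lemma lcoef2_act_mu_lambda a b v n m :
  lcoef (lcoef (act_mu_lambda op b a v) n) m =
  lcoef (op b (lcoef (op a v) m)) n.
Proof.
rewrite /act_mu_lambda /lsubst !lcoef_sum.
rewrite -(@sum_lsupp_delta _ _ _ (fun i => lcoef (op b (lcoef (op a v) i)) n) (op a v));
  last by move=> ->; rewrite op0r lcoef0.
apply: eq_bigr => i _; rewrite -rmorphXn lcoefCZ lcoefXnZ.
case: ltngtP => [lt_in|lt_ni|->] //; last by rewrite subnn lcoef2_act_at_mu.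
by rewrite lcoef2_act_at_mu ifN // subn_eq0 -ltnNge.
Qed.

(** The i-th coefficient of [p] comes with lambda^i, which leaves lambda^(m - i) mu^n to the
    expansion in lambda + mu. *)
Lemma lcoef2_act_lambda_plus_mu (p : lpoly A) v n m :
  lcoef (lcoef (act_lambda_plus_mu op p v) n) m =
  \sum_(i < m.+1) lcoef (op (lcoef p i) v) (m - i + n) *+ 'C(m - i + n, n).
Proof.
rewrite /act_lambda_plus_mu /lsubst !lcoef_sum.
pose f i := if (i <= m)%N
  then lcoef (op (lcoef p i) v) (m - i + n) *+ 'C(m - i + n, n) else 0.
transitivity (\sum_(i <- lsupp p) f i).
  apply: eq_bigr => i _; rewrite -rmorphXn lcoefCZ lcoefXnZ /f.
  by case: ifP => // _; rewrite lcoef2_act_at_sum.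
rewrite (@sum_lsupp _ _ _ _ _ m.+1).
- by apply: eq_bigr => i _; rewrite /f -ltnS ltn_ord.
- by move=> i pi; rewrite /f pi op0l lcoef0 mul0rn; case: ifP.
by move=> i lt_mi; rewrite /f leqNgt lt_mi.
Qed.

End ActionCoefficients.

(** * Linear algebra over the scalars inside a C[d]-module *)

Section ScalarLinearAlgebra.
Variables (F : fieldType) (V : lmodType {poly F}).
Implicit Types (f : V -> V) (q r : {poly F}) (c : F) (u v w : V) (s : seq V).

(** Scalars act through constant polynomials. Coefficients of an action respect these but need not
    commute with d, so linearity over [{poly F}] would be too strong. *)
Definition scalar_linear f : Prop :=
  {morph f : v w / v + w} /\ forall c v, f (c%:P *: v) = c%:P *: f v.

Definition generates s : Prop :=
  forall v, exists p : nat -> {poly F}, v = \sum_(i < size s) p i *: s`_i.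

Lemma scalar_eq0 c v : c != 0 -> c%:P *: v = 0 -> v = 0.
Proof.
move=> c0 cv0; rewrite -[v]scale1r -polyC1 -(mulVf c0) polyCM -scalerA cv0.
exact: scaler0.
Qed.

Lemma scalar_linear0 f : scalar_linear f -> f 0 = 0.
Proof. by case=> fD _; apply: (@addIr _ (f 0)); rewrite -fD !add0r. Qed.

Lemma scalar_linearB f v w : scalar_linear f -> f (v - w) = f v - f w.
Proof. by move=> [fD fC]; rewrite -scaleN1r -polyCN fD fC polyCN scaleN1r. Qed.

Lemma scalar_linear_sum f I (r : seq I) (P : pred I) (G : I -> V) :
  scalar_linear f ->
  f (\sum_(i <- r | P i) G i) = \sum_(i <- r | P i) f (G i).
Proof. by move=> flin; apply: big_morph => //; [exact: flin.1 | exact: scalar_linear0]. Qed.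

Lemma scalar_linear_iter f n : scalar_linear f -> scalar_linear (iter n f).
Proof.
move=> [fD fC]; elim: n => [|n [IHD IHC]]; first by split.
  by split=> [v w|c v] /=; rewrite ?IHD ?fD ?IHC ?fC.
Qed.

Lemma sum_size_poly n q (G : nat -> V) : (size q <= n)%N ->
  \sum_(i < size q) (q`_i)%:P *: G i = \sum_(i < n) (q`_i)%:P *: G i.
Proof.
move=> le_qn; rewrite (big_ord_widen _ (fun i => (q`_i)%:P *: G i) le_qn).
rewrite big_mkcond; apply: eq_bigr => i _; case: ltnP => // le_qi.
by rewrite nth_default ?scale0r.
Qed.

(** The quotient V / X^N V has dimension at most [size s * N] over the scalars, so one vector more
    than that satisfies a linear relation; [q] collects its coefficients. *)
Lemma dependent_mod_Xn s N (w : nat -> V) : generates s ->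
  exists2 q : {poly F}, q != 0 &
    exists u, \sum_(i < size q) (q`_i)%:P *: w i = 'X^N *: u.
Proof.
move=> gen_s.
have [p wE] := choice (fun i => gen_s (w i)).
pose D := (size s * N)%N.
(* Row [i] lists the coefficients of degree below [N] of [w i] in terms of the generators. There is
   one more row than columns, hence a nonzero left kernel vector. *)
pose M : 'M[F]_(D.+1, D) :=
  \matrix_i mxvec (\matrix_(j < size s, k < N) (p i j)`_k).
have : kermx M != 0.
  rewrite kermx_eq0; apply/negP => /eqP rankM.
  by have := rank_leq_col M; rewrite rankM ltnn.
case/rowV0Pn => a /sub_kermxP aM a0.
pose q := \poly_(i < D.+1) a 0 (inord i).
have qE (i : 'I_D.+1) : q`_i = a 0 i by rewrite coef_poly ltn_ord inord_val.
exists q.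
  apply: contra_neq a0 => q0; apply/rowP => i.
  by rewrite -qE q0 coef0 mxE.
pose r (j : 'I_(size s)) := \sum_(i < D.+1) (a 0 i)%:P * p i j.
exists (\sum_(j < size s) drop_poly N (r j) *: s`_j).
rewrite (@sum_size_poly D.+1) ?size_poly //.
transitivity (\sum_(j < size s) r j *: s`_j).
  under eq_bigr => i _ do rewrite qE wE scaler_sumr.
  rewrite exchange_big; apply: eq_bigr => j _; rewrite scaler_suml.
  by apply: eq_bigr => i _; rewrite scalerA.
rewrite scaler_sumr; apply: eq_bigr => j _; rewrite scalerA mulrC.
congr (_ *: _); rewrite -[LHS](poly_take_drop N).
suff -> : take_poly N (r j) = 0 by rewrite add0r.
apply/polyP => k; rewrite coef_take_poly coef0; case: ltnP => // lt_kN.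
move/rowP/(_ (mxvec_index j (Ordinal lt_kN))): aM.
rewrite !mxE => aM0; rewrite -[RHS]aM0 coef_sum.
by apply: eq_bigr => i _; rewrite coefCM !mxE mxvecE mxE.
Qed.

(** This is q(f) w. *)
Definition opeval f q w : V := \sum_(i < size q) (q`_i)%:P *: iter i f w.

Lemma opeval_linear f q : scalar_linear f -> scalar_linear (opeval f q).
Proof.
move=> flin; split=> [v w|c v]; rewrite /opeval.
  rewrite -big_split; apply: eq_bigr => i _.
  by rewrite (scalar_linear_iter i flin).1 scalerDr.
rewrite scaler_sumr; apply: eq_bigr => i _.
by rewrite (scalar_linear_iter i flin).2 !scalerA mulrC.
Qed.

(** The linear factor is applied first, so that the roots of a split polynomial can be peeled off
    one at a time. *)
Lemma opevalM f q c w : scalar_linear f ->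
  opeval f (q * ('X - c%:P)) w = opeval f q (f w - c%:P *: w).
Proof.
move=> flin; rewrite /opeval (@sum_size_poly (size q).+1); last first.
  by rewrite (leq_trans (size_polyMleq _ _)) // size_XsubC addn2.
transitivity (\sum_(i < (size q).+1) ((q * 'X)`_i)%:P *: iter i f w -
    \sum_(i < (size q).+1) (q`_i * c)%:P *: iter i f w).
  rewrite -sumrB; apply: eq_bigr => i _.
  by rewrite mulrBr coefB coefMC polyCB scalerBl.
rewrite big_ord_recl coefMX eqxx scale0r add0r.
rewrite [X in _ - X]big_ord_recr /= nth_default // mul0r scale0r addr0.
rewrite -sumrB; apply: eq_bigr => i _.
rewrite coefMX /= -iterS iterSr scalar_linearB ?scalerBr; last exact: scalar_linear_iter.
by rewrite (scalar_linear_iter i flin).2 scalerA -polyCM.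
Qed.

Lemma opeval_eigen f q c w : scalar_linear f -> f w = c%:P *: w ->
  opeval f q w = q.[c]%:P *: w.
Proof.
move=> flin fw; rewrite /opeval horner_coef rmorph_sum scaler_suml.
apply: eq_bigr => i _; rewrite /= polyCM -scalerA; congr (_ *: _).
elim: (i : nat) => [|n IHn]; first by rewrite expr0 scale1r.
by rewrite iterS IHn flin.2 fw scalerA -polyCM exprSr.
Qed.

(* The last hypothesis says that the span of the [w i] meets X^N V trivially, so
   that it is finite-dimensional and cannot contain infinitely many eigenvectors. *)
Lemma distinct_eigen f N s (w : nat -> V) (c : nat -> F) :
    generates s -> scalar_linear f -> injective c ->
    (forall i, f (w i) = (c i)%:P *: w i) ->
    (forall q u, \sum_(i < size q) (q`_i)%:P *: w i = 'X^N *: u ->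
       \sum_(i < size q) (q`_i)%:P *: w i = 0) ->
  exists i, w i = 0.
Proof.
move=> gen_s flin c_inj fw indep.
have [q q0 [u /indep dep]] := dependent_mod_Xn N w gen_s.
pose n := (size q).-1.
have szq : size q = n.+1 by rewrite /n prednK // size_poly_gt0.
(* r(f) kills [w i] for i < n, so applied to the relation it leaves only the top term, with the
   nonzero coefficient q_n r(c_n). *)
exists n; pose r := \prod_(i < n) ('X - (c i)%:P).
have : opeval f r (\sum_(i < size q) (q`_i)%:P *: w i) = 0.
  by rewrite dep scalar_linear0 //; exact: opeval_linear.
have rlin := opeval_linear r flin.
rewrite scalar_linear_sum // szq big_ord_recr /= big1 ?add0r => [|i _].
  rewrite rlin.2 (opeval_eigen _ flin (fw n)) scalerA -polyCM.
  apply: scalar_eq0; apply: mulf_neq0.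
    by rewrite -[n]/(n.+1.-1) -szq -lead_coefE lead_coef_eq0.
  rewrite horner_prod prodf_seq_neq0; apply/allP => i _ /=.
  rewrite !hornerE subr_eq0; apply/eqP => /c_inj E.
  by have := ltn_ord i; rewrite -E ltnn.
rewrite rlin.2 (opeval_eigen _ flin (fw i)) scalerA -polyCM.
rewrite horner_prod (bigD1 i) //= !hornerE subrr.
by rewrite /= mulr0 mul0r polyC0 scale0r.
Qed.

End ScalarLinearAlgebra.

(** Split [q] into linear factors and apply them to [w] one after the other: the last vector outside
    [K] is an eigenvector modulo [K]. *)
Lemma eigenvector_mod (F : closedFieldType) (V : lmodType {poly F})
    (f : V -> V) (W K : V -> Prop) (q : {poly F}) (w : V) :
    scalar_linear f ->
    (forall c v, W v -> W (f v - c%:P *: v)) ->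
    (forall c v, c != 0 -> K (c%:P *: v) -> K v) ->
    q != 0 -> W w -> ~ K w -> K (opeval f q w) ->
  exists c u, [/\ W u, ~ K u & K (f u - c%:P *: u)].
Proof.
move=> flin Wf Kscale q0 Ww nKw.
have [rs ->] := closed_field_poly_normal q.
have lq0 : lead_coef q != 0 by rewrite lead_coef_eq0.
set r := \prod_(z <- rs) _.
have -> : opeval f (lead_coef q *: r) w = (lead_coef q)%:P *: opeval f r w.
  rewrite /opeval size_scale // scaler_sumr; apply: eq_bigr => i _.
  by rewrite coefZ polyCM scalerA.
move/(Kscale _ _ lq0); rewrite {}/r.
elim: rs w Ww nKw => [|z rs IHrs] w Ww nKw.
  rewrite big_nil /opeval size_poly1 big_ord1 coef1 scale1r.
  by move=> /nKw.
rewrite big_cons mulrC opevalM // => Kfw.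
have [Kz|nKz] := pselect (K (f w - z%:P *: w)); first by exists z, w.
by apply: (IHrs _ _ nKz Kfw); apply: Wf.
Qed.

(** * The coefficient operators of a conformal module *)

Section Modes.
Variables (F : fieldType) (A : lieConformalAlgebra F) (V : conformalModule A).
Implicit Types (a b : A) (u v w : V) (p q : {poly F}) (c : F) (m n : nat).

Definition mode a n v : V := lcoef (act a v) n.

Lemma mode_linear a n : scalar_linear (mode a n).
Proof.
split=> [v w|c v]; rewrite /mode.
  exact: (lcoef_op_add (act_bilinear V)).
exact: (lcoef_opC (act_bilinear V)).
Qed.

Lemma mode0Z a p v : mode a 0 (p *: v) = p *: mode a 0 v.
Proof. exact: (lcoef_op0Z (act_bilinear V) (act_sesquilinear V)). Qed.

Lemma modeX a n v :
  mode a n ('X *: v) = 'X *: mode a n v + (if n is m.+1 then mode a m v else 0).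
Proof.
rewrite /mode (act_sesquilinear V).2 scalerDl lcoefD lcoefCZ.
rewrite -[lambda1]expr1 lcoefXnZ.
by case: n => [|n] //; rewrite subn1.
Qed.

Lemma modeXl a n v :
  mode ('X *: a) n v = if n is m.+1 then - mode a m v else 0.
Proof. exact: (lcoef_opXl (act_sesquilinear V)). Qed.

(** This compares the coefficients of lambda^m mu^n in the module axiom. *)
Lemma mode_commutator a b m n v :
  mode a m (mode b n v) - mode b n (mode a m v) =
  \sum_(i < m.+1) mode (lcoef (bracket a b) i) (m - i + n) v *+ 'C(m - i + n, n).
Proof.
rewrite /mode -(lcoef2_act_lambda_mu (act_bilinear V) a b v n m).
rewrite -(lcoef2_act_mu_lambda (act_bilinear V) a b v n m).
rewrite -(lcoef2_act_lambda_plus_mu (act_bilinear V) (bracket a b) v n m).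
by rewrite -act_bracket 2!lcoefB.
Qed.

(** [P] does not depend on [v], so a C[d]-submodule stable under the coefficients of [L] and [H] is
    stable under those of [a]. *)
Lemma act_span (L H : A) a :
    (exists p : {poly F} * {poly F}, a = p.1 *: L + p.2 *: H) ->
  exists P : {poly {poly F}} * {poly {poly F}},
    forall v, act a v = P.1 *: act L v + P.2 *: act H v.
Proof.
case=> p ->; exists (p.1^:P \Po (- 'X), p.2^:P \Po (- 'X)) => v /=.
rewrite (opDl (act_bilinear V)).
by rewrite !(opZl (act_bilinear V) (act_sesquilinear V)).
Qed.

(* Since [a_lambda (p(d) v) = p(d + lambda) a_lambda v] and [p(d + lambda)] has
   a scalar leading coefficient in lambda. *)
Lemma act_scale_low a p v : p != 0 ->
    (forall n, ((size p).-1 <= n)%N -> mode a n (p *: v) = 0) ->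
  act a v = 0.
Proof.
move=> p0; rewrite /mode.
rewrite (opZr (act_bilinear V) (act_sesquilinear V)).
have szX : size ('X + 'X%:P : {poly {poly F}}) = 2%N by rewrite size_XaddC.
have szp : size (p^:P \Po ('X + 'X%:P)) = size p.
  by rewrite size_comp_poly2 // size_map_polyC.
rewrite -szp => low; apply: lpoly_mul_low_eq0 low => w.
rewrite lead_coef_comp ?szX // lead_coefXaddC expr1n mulr1.
rewrite lead_coef_map_inj ?polyC0 //; last exact: polyC_inj.
by apply: scalar_eq0; rewrite lead_coef_eq0.
Qed.

End Modes.

(** * Commutation relations between the coefficients of L and H *)

Section HeisenbergVirasoroModes.
Variables (F : fieldType) (A : lieConformalAlgebra F) (L H : A).
Variables (HV : is_heisenberg_virasoro L H) (V : conformalModule A).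
Implicit Types (u v w : V) (p q : {poly F}) (c : F) (m n : nat).

Lemma bracket_coefs (a b : A) c :
    bracket a b = (d1 + cst1 c * lambda1) *: lconst b ->
  [/\ lcoef (bracket a b) 0 = 'X *: b, lcoef (bracket a b) 1 = c%:P *: b
    & forall i, lcoef (bracket a b) i.+2 = 0].
Proof.
move=> ->; split => [||i]; rewrite lcoefZ_const coefD coefC coefCM coefX /=.
- by rewrite mulr0 addr0.
- by rewrite mulr1 add0r.
by rewrite mulr0 addr0 scale0r.
Qed.

(** Serves [[L, L]] with c = 2 and [[L, H]] with c = 1. The term c lambda of the bracket gives the
    first binomial; the term d gives the second, with a sign because d acts as -(lambda + mu). *)
Lemma mode_commutator_primary (a b : A) c m n v :
    bracket a b = (d1 + cst1 c * lambda1) *: lconst b ->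
  mode a m.+1 (mode b n v) - mode b n (mode a m.+1 v) =
  (c * 'C(m + n, n)%:R - 'C((m + n).+1, n)%:R)%:P *: mode b (m + n) v.
Proof.
case/bracket_coefs => ab0 ab1 ab2; rewrite mode_commutator.
rewrite 2!big_ord_recl /= big1 => [|i _]; last first.
  by rewrite ab2 /mode (op0l (act_bilinear V)) lcoef0 mul0rn.
rewrite /bump /= ab0 ab1 subn0 subn1 addr0 addSn modeXl /= /mode.
rewrite (opCl (act_bilinear V)) lcoefCZ.
rewrite polyCB scalerBl addrC mulNrn; congr (_ - _).
  by rewrite polyCM -scalerA polyC_natr scaler_nat scalerMnr.
by rewrite polyC_natr scaler_nat.
Qed.

Lemma mode0_commutator_primary (a b : A) c n v :
    bracket a b = (d1 + cst1 c * lambda1) *: lconst b ->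
  mode a 0 (mode b n v) - mode b n (mode a 0 v) =
  - (if n is m.+1 then mode b m v else 0).
Proof.
case/bracket_coefs => ab0 _ _; rewrite mode_commutator big_ord1 subn0 /=.
by rewrite ab0 modeXl add0n binn; case: n => [|n] //; rewrite oppr0.
Qed.

Lemma bracketLL : bracket L L = (d1 + cst1 2%:R * lambda1) *: lconst L.
Proof. by case: HV => _ -> _ _; rewrite /cst1 !polyC_natr. Qed.

Lemma bracketLH : bracket L H = (d1 + cst1 1 * lambda1) *: lconst H.
Proof. by case: HV => _ _ -> _; rewrite /cst1 !polyC1 mul1r. Qed.

Lemma mode_HH m n v : mode H m (mode H n v) = mode H n (mode H m v).
Proof.
apply/eqP; rewrite -subr_eq0 mode_commutator; case: HV => _ _ _ ->.
rewrite big1 // => i _.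
by rewrite lcoef0 /mode (op0l (act_bilinear V)) lcoef0 mul0rn.
Qed.

Lemma submoduleP (U : V -> Prop) :
    U 0 -> (forall u v, U u -> U v -> U (u + v)) ->
    (forall p u, U u -> U (p *: u)) ->
    (forall n u, U u -> U (mode L n u)) -> (forall n u, U u -> U (mode H n u)) ->
  is_submodule U.
Proof.
move=> U0 UD UZ UL UH; split => // a u i Uu.
case: HV => /(_ a) [p [ap _]] _ _ _.
have [P ->] := @act_span _ _ V L H a (ex_intro _ p ap).
have Usum (I : Type) (r : seq I) (Q : pred I) (G : I -> V) :
    (forall j, U (G j)) -> U (\sum_(j <- r | Q j) G j).
  by move=> UG; apply: big_ind => // j _; apply: UG.
rewrite lcoefD !lcoefZ; apply: UD; apply: Usum => j; apply: UZ.
  exact: UL.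
exact: UH.
Qed.

End HeisenbergVirasoroModes.

(** * Irreducible modules: torsion, the spaces V_N and Schur's lemma *)

Section Classification.
Variables (F : numClosedFieldType) (A : lieConformalAlgebra F) (L H : A).
Hypothesis HV : is_heisenberg_virasoro L H.
Variable V : conformalModule A.
Hypotheses (finV : finite_module V) (irrV : irreducible V).
Hypothesis nontrivV : ~ trivial V.
Implicit Types (a : A) (u v w : V) (p q : {poly F}) (c : F) (m n N : nat).

Local Notation ell := (mode (V := V) L).
Local Notation eta := (mode (V := V) H).

Lemma mode_r0 a n : mode a n (0 : V) = 0.
Proof. exact: scalar_linear0 (mode_linear V a n). Qed.

Lemma irreducible_cases (U : V -> Prop) :
    U 0 -> (forall u v, U u -> U v -> U (u + v)) ->
    (forall p u, U u -> U (p *: u)) ->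
    (forall n u, U u -> U (ell n u)) -> (forall n u, U u -> U (eta n u)) ->
  (forall u, U u -> u = 0) \/ (forall u, U u).
Proof.
move=> U0 UD UZ UL UH.
have [U_eq0|UT] := irrV.2 U (submoduleP HV U0 UD UZ UL UH); last by right.
by left=> u /U_eq0.
Qed.

Lemma act_eq0 a v : (forall n, mode a n v = 0) -> act a v = 0.
Proof. by move=> av; apply/lpolyP => n; rewrite lcoef0; apply: av. Qed.

(** The vectors killed by [L] and [H] form a submodule, which is not all of [V] because [V] is
    nontrivial. *)
Lemma invariant_eq0 v : act L v = 0 -> act H v = 0 -> v = 0.
Proof.
pose U v := act L v = 0 /\ act H v = 0.
have U0 : U 0 by split; apply: act_eq0 => n; exact: mode_r0.
have [||||U_eq0 Lv Hv|UT] := @irreducible_cases U U0.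
- move=> u w [Lu Hu] [Lw Hw].
  by split; rewrite (opDr (act_bilinear V)) ?Lu ?Lw ?Hu ?Hw addr0.
- move=> p u [Lu Hu]; split;
    by rewrite (opZr (act_bilinear V) (act_sesquilinear V)) ?Lu ?Hu scaler0.
- by move=> n u [Lu _]; rewrite /mode Lu lcoef0.
- by move=> n u [_ Hu]; rewrite /mode Hu lcoef0.
- exact: U_eq0.
case: nontrivV => a w; case: HV => /(_ a) [p [ap _]] _ _ _.
have [P ->] := @act_span _ _ V L H a (ex_intro _ p ap).
by rewrite (UT w).1 (UT w).2 !scaler0 addr0.
Qed.

Lemma torsion_free p v : p != 0 -> p *: v = 0 -> v = 0.
Proof.
move=> p0 pv0.
by apply: invariant_eq0; apply: (act_scale_low p0) => n _; rewrite pv0 mode_r0.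
Qed.

(** This is the space V_N. *)
Definition order_le N v : Prop :=
  forall n, (N <= n)%N -> ell n v = 0 /\ eta n v = 0.

(** Unless a_lambda u = 0, multiplying it by (d + lambda)^N produces a nonzero coefficient of degree
    at least N; hence [L] and [H] kill [u]. *)
Lemma order_le_Xn N v u : order_le N v -> v = 'X^N *: u -> v = 0.
Proof.
move=> ord_v vE; suff u0 : u = 0 by rewrite vE u0 scaler0.
have XN0 : 'X^N != 0 :> {poly F} by rewrite monic_neq0 ?monicXn.
apply: invariant_eq0; apply: (act_scale_low XN0) => n; rewrite size_polyXn -vE.
  by case/ord_v.
by case/ord_v.
Qed.

Lemma order_le_exists v : exists N, order_le N v.
Proof.
have [N1 vL] := lcoef_eventually0 (act L v).
have [N2 vH] := lcoef_eventually0 (act H v).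
exists (maxn N1 N2) => n; rewrite geq_max => /andP[le1 le2].
by split; [exact: vL | exact: vH].
Qed.

Lemma order_le_sum N n (w : nat -> V) (k : nat -> F) :
    (forall i, order_le N (w i)) ->
  order_le N (\sum_(i < n) (k i)%:P *: w i).
Proof.
move=> ord_w m le_Nm; split; (rewrite scalar_linear_sum; last exact: mode_linear);
  rewrite big1 // => i _; have [Lw Hw] := ord_w i m le_Nm;
  by rewrite (mode_linear V _ _).2 ?Lw ?Hw scaler0.
Qed.

(** If dV were V, then d^N V would be V for every N, while each vector lies in some V_N. *)
Lemma not_divisible : exists w, ~ exists u, w = 'X *: u.
Proof.
apply: contrapT => no_w.
have divX v : exists u, v = 'X *: u.
  by apply: contrapT => nv; apply: no_w; exists v.
have [v v0] := irrV.1; have [N ord_v] := order_le_exists v.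
apply: v0; suff [u vE] : exists u, v = 'X^N *: u by apply: order_le_Xn vE.
elim: N {ord_v} => [|N [u ->]]; first by exists v; rewrite scale1r.
by have [y ->] := divX u; exists y; rewrite scalerA -exprSr.
Qed.

(** The eigenvalue is found on V / dV, which is nonzero and finite-dimensional even though [V] need
    not be. The kernel and the image of T - c are submodules, and T - c is not bijective. *)
Lemma schur (T : V -> V) :
    (forall p u v, T (p *: u + v) = p *: T u + T v) ->
    (forall n v, T (ell n v) = ell n (T v)) ->
    (forall n v, T (eta n v) = eta n (T v)) ->
  exists c, forall v, T v = c%:P *: v.
Proof.
move=> Tlin TL TH.
have TD v w : T (v + w) = T v + T w by rewrite -[v]scale1r Tlin !scale1r.
have T0 : T 0 = 0 by apply: (@addIr _ (T 0)); rewrite -TD !add0r.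
have TZ p v : T (p *: v) = p *: T v by rewrite -[p *: v]addr0 Tlin T0 addr0.
have Tscalar : scalar_linear T by split.
have [s gen_s] := finV.
have [w nXw] := not_divisible.
have [q q0 [y qw]] := dependent_mod_Xn 1 (fun i => iter i T w) gen_s.
have [c [u [_ nXu [z Tu]]]] : exists c u,
    [/\ True, ~ (exists z, u = 'X *: z) & exists z, T u - c%:P *: u = 'X *: z].
  apply: (@eigenvector_mod F V T (fun=> True) (fun v => exists u, v = 'X *: u) q w)
      => // [c v c0 [z cv]|]; last by exists y; rewrite -['X]expr1.
  exists (c^-1%:P *: z); rewrite scalerA mulrC -scalerA -cv scalerA -polyCM.
  by rewrite mulVf // scale1r.
pose g v := T v - c%:P *: v.
have gD v v' : g (v + v') = g v + g v'.
  by rewrite /g TD scalerDr opprD addrACA.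
have gZ p v : g (p *: v) = p *: g v.
  by rewrite /g TZ scalerBr !scalerA mulrC.
have gN v : g (- v) = - g v by rewrite -scaleN1r gZ scaleN1r.
have g0 : g 0 = 0 by rewrite /g T0 scaler0 subr0.
have gL n v : g (ell n v) = ell n (g v).
  by rewrite /g TL scalar_linearB ?(mode_linear V _ _).2 //; exact: mode_linear.
have gH n v : g (eta n v) = eta n (g v).
  by rewrite /g TH scalar_linearB ?(mode_linear V _ _).2 //; exact: mode_linear.
have [|||||ker_g|g_eq0] := @irreducible_cases (fun v => g v = 0).
- exact: g0.
- by move=> v v' gv gv'; rewrite gD gv gv' addr0.
- by move=> p v gv; rewrite gZ gv scaler0.
- by move=> n v gv; rewrite gL gv mode_r0.
- by move=> n v gv; rewrite gH gv mode_r0.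
- have [|||||im_g|g_onto] := @irreducible_cases (fun v => exists v', v = g v').
  + by exists 0.
  + by move=> _ _ [v ->] [v' ->]; exists (v + v').
  + by move=> p _ [v ->]; exists (p *: v).
  + by move=> n _ [v ->]; exists (ell n v).
  + by move=> n _ [v ->]; exists (eta n v).
  + case: nXu; exists 0; rewrite scaler0; apply: ker_g; apply: im_g.
    by exists u.
  (* If T - c were onto and injective, [u - 'X *: z'] would lie in its kernel, making [u] divisible
     by d. *)
  have [z' zE] := g_onto z.
  case: nXu; exists z'; apply/eqP; rewrite -subr_eq0; apply/eqP/ker_g.
  by rewrite gD gN gZ -zE -Tu subrr.
by exists c => v; apply/eqP; rewrite -subr_eq0; apply/eqP/g_eq0.
Qed.

(** L_0 and d have the same commutator -b_(n-1) with b_n. *)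
Lemma translation_commutes (b : A) c n v :
    bracket L b = (d1 + cst1 c * lambda1) *: lconst b ->
  ell 0 (mode b n v) - 'X *: mode b n v = mode b n (ell 0 v - 'X *: v).
Proof.
move=> /(mode0_commutator_primary n v) /eqP; rewrite subr_eq => /eqP E.
rewrite scalar_linearB; last exact: mode_linear.
by rewrite modeX E opprD addrA -[LHS]addrA [LHS]addrC.
Qed.

Lemma ell0_scalar : exists c, forall v, ell 0 v = 'X *: v + c%:P *: v.
Proof.
have [|n v|n v|c Tc] := @schur (fun v => ell 0 v - 'X *: v).
- move=> p u v; rewrite (mode_linear V _ _).1 mode0Z scalerDr opprD addrACA.
  by rewrite scalerBr !scalerA [p * 'X]mulrC.
- exact: translation_commutes (bracketLL HV).
- exact: translation_commutes (bracketLH HV).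
by exists c => v; rewrite -Tc addrC subrK.
Qed.

(** Stability of V_N depends only on the index m + n, so the constant is left unspecified. *)
Lemma mode_commutator_mult (b : A) c m n v :
    bracket L b = (d1 + cst1 c * lambda1) *: lconst b ->
  exists k : F, ell m.+1 (mode b n v) =
    mode b n (ell m.+1 v) + k%:P *: mode b (m + n) v.
Proof.
move=> /(mode_commutator_primary m n v) /eqP.
by rewrite subr_eq addrC => /eqP E; eexists; exact: E.
Qed.

(** H_0 commutes with L_(n+1) because the constant c - 1 of the commutator vanishes for c = 1. *)
Lemma eta0_scalar : exists c, forall v, eta 0 v = c%:P *: v.
Proof.
apply: schur => [p u v|n v|n v].
- by rewrite (mode_linear V _ _).1 mode0Z.
- apply/eqP; rewrite eq_sym -subr_eq0; apply/eqP; case: n => [|n].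
    by rewrite (mode0_commutator_primary 0 v (bracketLH HV)) oppr0.
  rewrite (mode_commutator_primary n 0 v (bracketLH HV)).
  by rewrite !bin0 mulr1 subrr polyC0 scale0r.
exact: (mode_HH HV).
Qed.

(** * Stability of V_N and the descent along eigenvectors of L_1 *)

Lemma order_le_ell N n v : order_le N v -> order_le N (ell n.+1 v).
Proof.
move=> ord_v m le_Nm.
have le_N : (N <= n + m)%N by rewrite (leq_trans le_Nm) ?leq_addl.
split.
  have [k] := mode_commutator_mult n m v (bracketLL HV).
  by rewrite (ord_v m le_Nm).1 (ord_v _ le_N).1 mode_r0 scaler0 addr0.
have [k] := mode_commutator_mult n m v (bracketLH HV).
by rewrite (ord_v m le_Nm).2 (ord_v _ le_N).2 mode_r0 scaler0 addr0.
Qed.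

(** The commutator of L_0 with H_(n+1) is -H_n, of lower index; [0 < N] excludes this case. *)
Lemma order_le_eta N n v :
  (0 < N)%N -> order_le N v -> order_le N (eta n.+1 v).
Proof.
move=> N0 ord_v m le_Nm; split; last first.
  by rewrite (mode_HH HV) (ord_v m le_Nm).2 mode_r0.
case: m le_Nm => [|m] le_Nm; first by rewrite leqNgt N0 in le_Nm.
have le_N : (N <= m + n.+1)%N by rewrite (leq_trans le_Nm) // addnS ltnS leq_addr.
have [k ->] := mode_commutator_mult m n.+1 v (bracketLH HV).
by rewrite (ord_v _ le_N).2 (ord_v _ le_Nm).1 mode_r0 scaler0 addr0.
Qed.

Definition eigen v : Prop := exists c, ell 1 v = c%:P *: v.

(* A ladder operator shifts the [ell 1]-eigenvalue by a nonzero integer, hence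
   is locally nilpotent on eigenvectors in the finite-dimensional [W]. *)
Lemma ladder_kernel N (W : V -> Prop) (x : V -> V) k v :
    (forall u, W u -> order_le N u) ->
    (forall u, W u -> W (x u)) -> scalar_linear x ->
    (forall u, W u -> ell 1 (x u) = x (ell 1 u) - (k.+1%:R)%:P *: x u) ->
    W v -> v <> 0 -> eigen v ->
  exists u, [/\ W u, u <> 0, eigen u & x u = 0].
Proof.
move=> W_ord Wx xlin ell_x Wv v0 [c ell_v].
pose w i := iter i x v; pose d i : F := c - (k.+1 * i)%:R.
have Ww i : W (w i) by elim: i => [|i /Wx].
have ell_w i : ell 1 (w i) = (d i)%:P *: w i.
  elim: i => [|i IHi]; first by rewrite /d muln0 subr0.
  rewrite -[w i.+1]/(x (w i)) ell_x // IHi xlin.2 -scalerBl -polyCB.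
  by rewrite /d mulnS natrD opprD addrA addrAC.
(* Characteristic zero makes the shifted eigenvalues pairwise distinct. *)
have d_inj : injective d.
  move=> i j /addrI /oppr_inj /eqP; rewrite eqr_nat eqn_mul2l /=.
  by move/eqP.
have [s gen_s] := finV.
have : exists i, w i == 0.
  have [|i wi0] := distinct_eigen (N := N) gen_s (mode_linear V L 1) d_inj ell_w.
    move=> q u qw; apply: order_le_Xn qw; apply: order_le_sum => i.
    exact: W_ord.
  by exists i; apply/eqP.
case/ex_minnP => -[|i] /eqP wi0 min_i; first by case: v0.
exists (w i); split=> //; last by exists (d i).
by move=> /eqP /min_i; rewrite ltnn.
Qed.

(** The order is padded to at least 2, the level at which the descent ends. *)
Lemma eigen_exists : exists N v, [/\ order_le N.+2 v, v <> 0 & eigen v].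
Proof.
have [v v0] := irrV.1; have [N ord_v] := order_le_exists v.
have [s gen_s] := finV; exists N.
have ord2 : order_le N.+2 v.
  by move=> n le_n; apply: ord_v; rewrite (leq_trans _ le_n) // -addn2 leq_addr.
have [q q0 [y qv]] := dependent_mod_Xn N.+2 (fun i => iter i (ell 1) v) gen_s.
have ord_iter i : order_le N.+2 (iter i (ell 1) v).
  by elim: i => [|i IHi] //=; apply: order_le_ell.
have [c [u [ord_u u0 /eqP]]] : exists c u, [/\ order_le N.+2 u, ~ (u = 0)
    & ell 1 u - c%:P *: u = 0].
  apply: (@eigenvector_mod F V (ell 1) (order_le N.+2) (fun u => u = 0) q v) => //.
  - exact: mode_linear.
  - move=> c u ord_u n le_n; split; rewrite scalar_linearB ?(mode_linear V _ _).2;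
      try exact: mode_linear.
      by rewrite (order_le_ell 0 ord_u le_n).1 (ord_u n le_n).1 scaler0 subr0.
    by rewrite (order_le_ell 0 ord_u le_n).2 (ord_u n le_n).2 scaler0 subr0.
  - by move=> c u; apply: scalar_eq0.
  (* The relation among the iterates holds only modulo X^(N+2), but its left side lies in V_(N+2)
     and therefore vanishes. *)
  by apply: (order_le_Xn _ qv); exact: order_le_sum.
by rewrite subr_eq0 => /eqP ell_u; exists u; split=> //; exists c.
Qed.

(** The shift is 1 - (n + 1). *)
Lemma ell1_eta n v : ell 1 (eta n v) = eta n (ell 1 v) - n%:R%:P *: eta n v.
Proof.
have /eqP := mode_commutator_primary 0 n v (bracketLH HV).
rewrite subr_eq addrC => /eqP ->; congr (_ + _); rewrite -scaleNr -polyCN.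
congr (_%:P *: _); rewrite !add0n binn binSn -addn1 natrD.
by ring.
Qed.

(** The shift is 2 - (n + 2). It vanishes for L_1 itself, so only L_2, L_3, ... are ladder
    operators. *)
Lemma ell1_ell n v :
  ell 1 (ell n.+1 v) = ell n.+1 (ell 1 v) - n%:R%:P *: ell n.+1 v.
Proof.
have /eqP := mode_commutator_primary 0 n.+1 v (bracketLL HV).
rewrite subr_eq addrC => /eqP ->; congr (_ + _); rewrite -scaleNr -polyCN.
congr (_%:P *: _); rewrite !add0n binn binSn -addn2 natrD.
by ring.
Qed.

(** H_(N+2) is treated first. Its kernel in V_(N+3) is stable under L_(N+2), since their commutator
    is a multiple of H_(2N+3), which vanishes on V_(N+3). *)
Lemma eigen_descent N v : order_le N.+3 v -> v <> 0 -> eigen v ->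
  exists u, [/\ order_le N.+2 u, u <> 0 & eigen u].
Proof.
move=> ord_v v0 eig_v.
have [|||u [ord_u u0 eig_u eta_u]] :=
    @ladder_kernel N.+3 (order_le N.+3) (eta N.+2) N.+1 v _ _ (mode_linear V H N.+2)
      _ ord_v v0 eig_v => //.
- by move=> u; apply: order_le_eta.
- by move=> u _; exact: ell1_eta.
have [||u' ||w [[ord_w eta_w] w0 eig_w ell_w]] :=
    @ladder_kernel N.+3 (fun u => order_le N.+3 u /\ eta N.+2 u = 0)
      (ell N.+2) N u _ _ (mode_linear V L N.+2) _ _ u0 eig_u.
- by move=> ? [].
- move=> x [ord_x eta_x]; split; first exact: order_le_ell.
  have [k] := mode_commutator_mult N.+1 N.+2 x (bracketLH HV).
  have le_N : (N.+3 <= N.+1 + N.+2)%N by lia.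
  by rewrite eta_x mode_r0 (ord_x _ le_N).2 scaler0 addr0.
- by move=> _; exact: ell1_ell.
- by split.
exists w; split=> // n; rewrite leq_eqVlt => /predU1P[<-|]; first by split.
exact: ord_w.
Qed.

(** On V_2 the operator H_1 still shifts eigenvalues by -1, so one last ladder step removes it; L_1
    remains with its eigenvalue. *)
Lemma primary_vector_exists : exists v c,
  [/\ v <> 0, ell 1 v = c%:P *: v, forall n, ell n.+2 v = 0
    & forall n, eta n.+1 v = 0].
Proof.
have [N [v [ord_v v0 eig_v]]] := eigen_exists.
elim: N v ord_v v0 eig_v => [|N IHN] v ord_v v0 eig_v; last first.
  by have [u []] := eigen_descent ord_v v0 eig_v; apply: IHN.
have [|||u [ord_u u0 [c ell_u] eta_u]] :=
    @ladder_kernel 2 (order_le 2) (eta 1) 0 v _ _ (mode_linear V H 1)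
      _ ord_v v0 eig_v => //.
- by move=> u; apply: order_le_eta.
- by move=> u _; exact: ell1_eta.
exists u, c; split=> // n; first by case: (ord_u n.+2).
by case: n => [|n] //; case: (ord_u n.+2).
Qed.

(** * The normal form of rank one *)

Theorem rank_one_classification :
  exists (Delta alpha beta : F),
    (Delta <> 0 \/ beta <> 0) /\ is_M L H Delta alpha beta V.
Proof.
have [alpha ell0] := ell0_scalar; have [beta eta0] := eta0_scalar.
have [v [Delta [v0 ell1 ell2 eta1]]] := primary_vector_exists.
have LvE : act L v = (d1 + cst1 alpha + cst1 Delta * lambda1) *: lconst v.
  apply/lpolyP => n; rewrite lcoefZ_const !coefD !coefC coefCM coefX.
  case: n => [|[|n]] /=; rewrite -/(mode _ _ _).
  - by rewrite ell0 mulr0 addr0 scalerDl.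
  - by rewrite ell1 !add0r mulr1.
  by rewrite ell2 !add0r mulr0 scale0r.
have HvE : act H v = cst1 beta *: lconst v.
  apply/lpolyP => n; rewrite lcoefZ_const coefC -/(mode _ _ _).
  by case: n => [|n]; rewrite ?eta0 // eta1 scale0r.
have act_v a (P : {poly {poly F}}) n p : act a v = P *: lconst v ->
    mode a n (p *: v) = ((p^:P \Po ('X + 'X%:P)) * P)`_n *: v.
  move=> avE; rewrite /mode (opZr (act_bilinear V) (act_sesquilinear V)) avE.
  by rewrite scalerA lcoefZ_const.
(* C[d]v is a submodule, and it contains v, which is nonzero. *)
have gen_v w : exists p, w = p *: v.
  have [|||||v_eq0|] := @irreducible_cases (fun w => exists p, w = p *: v) => //.
  - by exists 0; rewrite scale0r.
  - by move=> _ _ [p ->] [p' ->]; exists (p + p'); rewrite scalerDl.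
  - by move=> p _ [p' ->]; exists (p * p'); rewrite scalerA.
  - by move=> n _ [p ->]; eexists; exact: act_v LvE.
  - by move=> n _ [p ->]; eexists; exact: act_v HvE.
  by case: v0; apply: v_eq0; exists 1; rewrite scale1r.
have free_v p p' : p *: v = p' *: v -> p = p'.
  move=> E; apply/eqP; rewrite -subr_eq0; apply: contra_notT v0 => ne.
  by apply: (torsion_free ne); rewrite scalerBl E subrr.
exists Delta, alpha, beta; split; last first.
  exists v; split=> // w; have [p wE] := gen_v w; exists p; split=> // p' wE'.
  by apply: free_v; rewrite -wE.
have [D0|/eqP] := eqVneq Delta 0; last by left.
have [b0|/eqP] := eqVneq beta 0; last by right.
(* For Delta = beta = 0 the subspace (d + alpha)V is a submodule. It is nonzero by torsion-freeness,
   so it is [V], and d + alpha would be a unit. *)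
pose r : {poly F} := 'X + alpha%:P.
have [|||||v_eq0|v_onto] := @irreducible_cases (fun w => exists p, w = (p * r) *: v).
- by exists 0; rewrite mul0r scale0r.
- by move=> _ _ [p ->] [p' ->]; exists (p + p'); rewrite mulrDl scalerDl.
- by move=> p _ [p' ->]; exists (p * p'); rewrite scalerA mulrA.
- move=> n _ [p ->]; rewrite (act_v _ _ _ _ LvE) D0 /cst1 polyC0 mul0r addr0.
  by rewrite -polyCD coefMC; eexists.
- move=> n _ [p ->]; rewrite (act_v _ _ _ _ HvE) b0 /cst1 polyC0 mulr0 coef0.
  by exists 0; rewrite mul0r !scale0r.
- case: v0; apply: (@torsion_free r); first by rewrite -size_poly_eq0 size_XaddC.
  by apply: v_eq0; exists 1; rewrite mul1r.
have [p vE] := v_onto v.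
have /free_v E : 1 *: v = (p * r) *: v by rewrite scale1r -vE.
have : (r %| 1)%R by rewrite E dvdp_mull.
by rewrite dvdp1 size_XaddC.
Qed.

End Classification.

Theorem corollary3p8 (R : realType) (A : lieConformalAlgebra R[i]) (L H : A)
    (HV : is_heisenberg_virasoro L H) (V : conformalModule A)
    (finV : finite_module V) (irrV : irreducible V) (nontrivV : ~ trivial V) :
  exists (Delta alpha beta : R[i]) (M : conformalModule A),
    [/\ Delta <> 0 \/ beta <> 0,
        is_M L H Delta alpha beta M &
        isomorphic V M].
Proof.
have [Delta [alpha [beta [nz isM]]]] :=
  rank_one_classification HV finV irrV nontrivV.
(* [V] itself has the required form, so the isomorphism is the identity. *)
exists Delta, alpha, beta, V; split=> //.
by exists [the {linear V -> V} of idfun]; split=> //; exists idfun.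
Qed.
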